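(* For each $n\ge 2$ let $1\le k=k_n\le n-1$ and consider the biased exclusion process on the segment of length $n$ with $k$ particles and bias $\beta=\beta_n=2p_n-1\in(0,1)$. Set $\alpha=\sqrt{p_n/(1-p_n)}$. For every $\varepsilon>0$, if $n$ is large enough, then $$t_{\rm mix}(\varepsilon)\ \le\ \frac{2n}{\beta^2}\left[\log(1/\varepsilon)+\log\left[\frac{\alpha(\alpha^k-1)(\alpha^{n-k}-1)}{(\alpha-1)^2}\right]\right].$$ In particular, if $\beta_n\le b$ for all $n$, where $b<1$ is a constant, then $\alpha=1+\beta+O(\beta^2)$ and, for every $\varepsilon>0$ and $n$ large enough, $$t_{\rm mix}(\varepsilon)\ \le\ \frac{2n}{\beta^2}\Bigl[\log(\varepsilon^{-1})+n[\beta+O(\beta^2)]-2\log\beta+O(\beta)\Bigr],$$ where the constants implied by the $O(\cdot)$ terms depend only on $b$.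
   Context: The $\beta$-biased exclusion process on $\{1,\ldots,n\}$ with $k$ particles is the discrete-time Markov chain on the set of configurations $\sigma\in\{0,1\}^n$ with exactly $k$ ones (particles), with the following transitions. At each step choose one of the $n-1$ edges $\{i,i+1\}$ of the path uniformly at random. If both endpoints are occupied or both are vacant, do nothing. If exactly one endpoint is occupied, place the particle on the right vertex $i+1$ with probability $p=(1+\beta)/2$ and on the left vertex $i$ with probability $q=1-p=(1-\beta)/2$. This chain is reversible and ergodic with a unique stationary distribution $\pi$. The mixing time is $$t_{\rm mix}(\varepsilon)=\min\{t\ge 0:\ \max_{\sigma}\|\mathbf P_\sigma(X_t\in\cdot)-\pi\|_{\rm TV}<\varepsilon\}.$$ *)

(* Defs.v *)
(* MathComp / MathComp-Analysis *)
From HB Require Import structures.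
From mathcomp Require Import all_boot all_order all_algebra.
From mathcomp Require Import all_classical all_reals all_analysis.

Set Implicit Arguments.
Unset Strict Implicit.
Unset Printing Implicit Defensive.

Import Order.TTheory GRing.Theory Num.Theory.

Local Open Scope classical_set_scope.
Local Open Scope ring_scope.

Section FiniteMarkovChain.
Context {R : realType} {S : finType}.
Implicit Types (P : S -> S -> R) (mu nu : S -> R).

Definition is_distribution mu : Prop :=
  (forall x, 0 <= mu x) /\ \sum_x mu x = 1.

Definition step P mu : S -> R := fun y => \sum_x mu x * P x y.

Definition law P (x : S) (t : nat) : S -> R :=
  iter t (step P) (fun y => (y == x)%:R).

Definition is_stationary P mu : Prop :=
  is_distribution mu /\ step P mu = mu.

(* The default value of xget is used only if P has no stationary
   distribution, which cannot happen for a stochastic P on nonempty S. *)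
Definition stationary_distribution P : S -> R :=
  xget (fun=> 0) [set mu | is_stationary P mu].

Definition tv_distance mu nu : R :=
  \big[Num.max/0]_(A : {set S})
    `|\sum_(x in A) mu x - \sum_(x in A) nu x|.

Definition worst_tv_distance P (t : nat) : R :=
  \big[Num.max/0]_(x : S) tv_distance (law P x t) (stationary_distribution P).

(* The infimum of a nonempty set of natural numbers is its minimum; the
   mixing time is +oo exactly when the distance never drops below eps. *)
Definition mixing_time P (eps : R) : \bar R :=
  ereal_inf [set (t%:R)%:E | t in [set t : nat | worst_tv_distance P t < eps]].

End FiniteMarkovChain.

Section BiasedExclusion.
Context {R : realType}.

(* Vertex i + 1 of the path {1, ..., n} is represented by i : 'I_n. *)
Definition config (n k : nat) :=
  {sigma : {ffun 'I_n -> bool} | #|[pred i | sigma i]| == k}.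

HB.instance Definition _ n k := SubFinite.on (config n k).

Lemma edge_right_subproof n (i : 'I_n.-1) : (i.+1 < n)%N.
Proof. by rewrite -ltn_predRL. Qed.

Definition edge_left n (i : 'I_n.-1) : 'I_n := widen_ord (leq_pred n) i.
Definition edge_right n (i : 'I_n.-1) : 'I_n := Ordinal (edge_right_subproof i).

(* sigma with a particle at u and a vacancy at v *)
Definition place n (sigma : {ffun 'I_n -> bool}) (u v : 'I_n) :
    {ffun 'I_n -> bool} :=
  [ffun x => if x == u then true else if x == v then false else sigma x].

Definition right_prob (beta : R) : R := (1 + beta) / 2.

Definition edge_transition n k (beta : R) (i : 'I_n.-1)
    (sigma tau : config n k) : R :=
  let l := edge_left i in
  let r := edge_right i in
  let p := right_prob beta in
  if val sigma l == val sigma r then (tau == sigma)%:R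
  else p * (val tau == place (val sigma) r l)%:R
       + (1 - p) * (val tau == place (val sigma) l r)%:R.

Definition exclusion_transition n k (beta : R) (sigma tau : config n k) : R :=
  (n.-1)%:R^-1 * \sum_(i < n.-1) edge_transition beta i sigma tau.

Definition exclusion_tmix (n k : nat) (beta eps : R) : \bar R :=
  mixing_time (@exclusion_transition n k beta) eps.

Definition alpha (beta : R) : R :=
  Num.sqrt (right_prob beta / (1 - right_prob beta)).

End BiasedExclusion.

(* Main.v *)
Require Import Defs.
From HB Require Import structures.
From mathcomp Require Import all_boot all_order all_algebra.
From mathcomp Require Import all_classical all_reals all_analysis.
From mathcomp Require Import zify ring lra.

(* Path coupling in dual form.  Two configurations that differ by one particle
   jump across an edge are put at distance [weight], the weight of the cell
   lying between the corresponding lattice paths.  With these weights, one step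
   of the chain shrinks the Lipschitz constant of every observable by the factor
   1 - (1 - sqrt (1 - beta^2)) / (n - 1) <= 1 - beta^2 / (2 (n - 1)): the edge
   of the discrepancy contributes nothing, and each of the two adjacent edges
   creates, with probability p (resp. 1 - p), a second discrepancy whose weight
   is 1 / alpha (resp. alpha) times that of the first one.  All weights are at
   least 1, so indicators are 1-Lipschitz, while a 1-Lipschitz observable
   oscillates by at most the total weight
   (alpha^k - 1) (alpha^(n-k) - 1) / (alpha - 1)^2 of the cells.  Applied to
   indicators after t steps this bounds the total variation distance. *)

Set Implicit Arguments.
Unset Strict Implicit.
Unset Printing Implicit Defensive.

Import Order.TTheory GRing.Theory Num.Theory.

Local Open Scope ring_scope.

(** * Finite Markov chains *)

Section MarkovChain.
Context {R : realType} {S : finType}.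
Implicit Types (P : S -> S -> R) (f : S -> R).

Definition is_stochastic P :=
  (forall x y, 0 <= P x y) /\ (forall x, \sum_y P x y = 1).

Definition markov_op P f : S -> R := fun x => \sum_y P x y * f y.

Lemma sum_step P (mu f : S -> R) :
  \sum_y step P mu y * f y = \sum_y mu y * markov_op P f y.
Proof.
rewrite /step /markov_op.
under eq_bigr do rewrite mulr_suml.
rewrite exchange_big; apply: eq_bigr => x _.
by rewrite mulr_sumr; apply: eq_bigr => y _; rewrite mulrA.
Qed.

Lemma sum_law P x t f :
  \sum_y law P x t y * f y = iter t (markov_op P) f x.
Proof.
elim: t f => [|t IH] f.
  rewrite /law /= (bigD1 x) //= eqxx mul1r big1 ?addr0 // => y /negbTE ->.
  by rewrite mul0r.
by rewrite iterSr -IH /law iterS sum_step.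
Qed.

Lemma sum_stationary P mu t f : is_stationary P mu ->
  \sum_y mu y * iter t (markov_op P) f y = \sum_y mu y * f y.
Proof.
case=> _ muP; elim: t => //= t IH.
by rewrite -[RHS]IH -sum_step muP.
Qed.

Lemma sum_enum_rank (F : 'I_#|S| -> R) :
  \sum_i F i = \sum_x F (enum_rank x).
Proof. by rewrite (reindex (@enum_rank S)) //; apply/onW_bij/enum_rank_bij. Qed.

(** The matrix P - I kills the constant column 1, which is nonzero because [x0] makes the space
    nonempty. Hence P - I is singular and has a nonzero left kernel vector. *)
Lemma stochastic_fixed_vector P (x0 : S) : is_stochastic P ->
  exists2 v : S -> R, exists x, v x != 0 & step P v = v.
Proof.
case=> _ P1.
pose M : 'M[R]_#|S| :=
  \matrix_(i, j) P (enum_val i) (enum_val j) - 1%:M.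
have MJ : M *m (const_mx 1 : 'cV_#|S|) = 0.
  apply/matrixP => i j; rewrite !mxE.
  under eq_bigr do rewrite !mxE mulr1.
  rewrite sumrB sum_enum_rank; under eq_bigr do rewrite enum_rankK.
  rewrite P1 (bigD1 i) //= eqxx big1 ?addr0 ?subrr // => l.
  by rewrite eq_sym => /negbTE ->.
have nfree : ~~ row_free M.
  apply/negP => freeM.
  have fullM : row_full M by rewrite /row_full; exact: freeM.
  have unitM : M \in unitmx by rewrite -row_full_unit.
  have /matrixP/(_ (enum_rank x0) ord0) : (const_mx 1 : 'cV[R]_#|S|) = 0.
    by rewrite -(mulKmx unitM (const_mx 1)) MJ mulmx0.
  by rewrite !mxE => /eqP; rewrite oner_eq0.
have [v vM v0] : exists2 v : 'rV_#|S|, v *m M = 0 & v != 0.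
  move: nfree; rewrite -kermx_eq0 => /rowV0Pn [v /sub_kermxP vM v0].
  by exists v.
exists (fun x => v 0 (enum_rank x)).
  have [j vj] := rV0Pn _ v0.
  by exists (enum_val j); rewrite enum_valK.
apply/funext => y; rewrite /step.
have /matrixP/(_ 0 (enum_rank y)) := vM.
rewrite /M mulmxBr mulmx1 !mxE => /eqP; rewrite subr_eq0 => /eqP <-.
rewrite sum_enum_rank; apply: eq_bigr => x _.
by rewrite !mxE !enum_rankK.
Qed.

(* If [v] is a left eigenvector for the eigenvalue 1, then so is [|v|]: the
   inequality [|v| <= |v| P] is an equality because both sides have the same
   sum. *)
Lemma stochastic_has_stationary P (x0 : S) : is_stochastic P ->
  exists mu, is_stationary P mu.
Proof.
move=> Pst; have [v [x vx] vP] := stochastic_fixed_vector x0 Pst.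
have [P0 P1] := Pst.
have Pv y : `|v y| <= step P (fun z => `|v z|) y.
  rewrite -{1}vP /step; apply: le_trans (ler_norm_sum _ _ _) _.
  by apply: ler_sum => z _; rewrite normrM [`|P _ _|]ger0_norm.
have absvP : step P (fun z => `|v z|) = fun z => `|v z|.
  apply/funext => y; apply/eqP; rewrite -subr_eq0.
  have : \sum_y (step P (fun z => `|v z|) y - `|v y|) == 0.
    rewrite sumrB subr_eq0 /step exchange_big /=; apply/eqP.
    by apply: eq_bigr => z _; rewrite -mulr_sumr P1 mulr1.
  rewrite psumr_eq0 => [/allP/(_ y)|z _]; last by rewrite subr_ge0.
  by rewrite mem_index_enum => /(_ isT).
have sum_gt0 : 0 < \sum_z `|v z|.
  rewrite (bigD1 x) //= ltr_pwDl ?normr_gt0 //.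
  by apply: sumr_ge0.
exists (fun z => `|v z| / \sum_z `|v z|); split; first split.
- by move=> z; rewrite divr_ge0 // ltW.
- by rewrite -mulr_suml divff // gt_eqF.
apply/funext => y; rewrite -[`|v y|](congr1 (@^~ y) absvP) /step mulr_suml.
by apply: eq_bigr => z _; rewrite mulrAC.
Qed.

(** Let g be the indicator of A after t applications of [markov_op P]. By stationarity mu(A) is the
    mu-average of g, so the error at x is an average of the differences g x - g y. *)
Lemma worst_tv_distance_lt P t (eps d : R) : is_stochastic P ->
  0 < eps -> d < eps ->
  (forall (A : {set S}) x y,
     `|iter t (markov_op P) (fun z => (z \in A)%:R) x
       - iter t (markov_op P) (fun z => (z \in A)%:R) y| <= d) ->
  worst_tv_distance P t < eps.
Proof.
move=> Pst eps0 d_eps osc.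
rewrite /worst_tv_distance /tv_distance.
apply/bigmax_ltP; split=> // x _; apply/bigmax_ltP; split=> // A _.
apply: le_lt_trans d_eps.
(* Existence ensures that [xget] returns a genuine stationary distribution and not its default
   value. *)
have [[mu0 mu1] muP] : is_stationary P (stationary_distribution P).
  have [mu statmu] := stochastic_has_stationary x Pst.
  exact: (xgetPex (fun=> 0) (ex_intro _ mu statmu)).
set mu := stationary_distribution P in mu0 mu1 muP *.
have sumA (nu : S -> R) :
    \sum_(y in A) nu y = \sum_y nu y * (y \in A)%:R.
  by rewrite big_mkcond /=; apply: eq_bigr => y _; case: ifP;
     rewrite ?mulr1 ?mulr0.
rewrite !sumA sum_law -(sum_stationary t _ (conj (conj mu0 mu1) muP)).
set g := iter t _ _.
have -> : g x - \sum_y mu y * g y = \sum_y mu y * (g x - g y).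
  under [RHS]eq_bigr do rewrite mulrBr.
  by rewrite sumrB -mulr_suml mu1 mul1r.
apply: le_trans (ler_norm_sum _ _ _) _.
rewrite -[leRHS]mul1r -mu1 mulr_suml; apply: ler_sum => y _.
rewrite normrM (ger0_norm (mu0 y)); apply: ler_wpM2l (mu0 y) _ _ _.
exact: osc.
Qed.

End MarkovChain.

(** * Configurations *)

Section Configurations.
Context {n k : nat}.
Implicit Types (x y : config n k) (j e : 'I_n.-1).

(* Indexing occupation numbers by [nat] (vacant outside the segment) avoids
   all ordinal casts between neighbouring vertices. *)
Definition occ x (i : nat) : bool :=
  if insub i is Some u then val x u else false.

Lemma occE x (u : 'I_n) : occ x u = val x u.
Proof. by rewrite /occ valK. Qed.

Lemma occ_out x i : (n <= i)%N -> occ x i = false.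
Proof. by move=> ni; rewrite /occ insubF // ltnNge ni. Qed.

Lemma occ_inj x y : occ x =1 occ y -> x = y.
Proof. by move=> xy; apply/val_inj/ffunP => u; rewrite -!occE. Qed.

Definition count_below x (i : nat) : nat := \sum_(m < i) occ x m.

Lemma count_belowS x i : count_below x i.+1 = (count_below x i + occ x i)%N.
Proof. by rewrite /count_below big_ord_recr. Qed.

Lemma count_below_size x : count_below x n = k.
Proof.
have /eqP xk : #|[pred i | val x i]| == k := valP x.
rewrite -[RHS]xk -sum1_card /count_below [RHS]big_mkcond /=.
by apply: eq_bigr => u _; rewrite occE inE; case: (val x u).
Qed.

Lemma count_below_le x i d : (count_below x (i + d) <= count_below x i + d)%N.
Proof.
elim: d => [|d IH]; first by rewrite !addn0.
by rewrite addnS count_belowS; case: (occ x _); lia.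
Qed.

(** The n - i sites from i on must hold the remaining k - [count_below x i] particles. *)
Lemma vacant_below_le x i : (i <= n)%N -> (i - count_below x i <= n - k)%N.
Proof.
move=> ni; have := count_below_le x i (n - i).
by rewrite subnKC // count_below_size; lia.
Qed.

Lemma count_below_bound x i : (count_below x i <= i)%N.
Proof. by have := count_below_le x 0 i; rewrite /count_below big_ord0. Qed.

(** * Resampling an edge *)

Definition set_edge (s : {ffun 'I_n -> bool}) j (b b' : bool) :
    {ffun 'I_n -> bool} :=
  [ffun u => if u == edge_left j then b
             else if u == edge_right j then b' else s u].

Lemma edge_neq j : edge_right j != edge_left j.
Proof. by apply/eqP => /(congr1 val) /=; lia. Qed.

Lemma card_set_edge (s : {ffun 'I_n -> bool}) j (b b' : bool) :
  (b + b' = s (edge_left j) + s (edge_right j))%N ->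
  #|[pred i | set_edge s j b b' i]| = #|[pred i | s i]|.
Proof.
have sum_edge (t : {ffun 'I_n -> bool}) : #|[pred i | t i]| =
    (t (edge_left j) + t (edge_right j)
     + \sum_(i | (i != edge_left j) && (i != edge_right j)) t i)%N.
  rewrite -sum1_card big_mkcond (bigD1 (edge_left j)) //=.
  rewrite (bigD1 (edge_right j)) ?edge_neq //= addnA !inE.
  by congr (_ + _ + _)%N; case: (t _).
move=> bb'; rewrite !sum_edge; congr (_ + _)%N.
  rewrite !ffunE !eqxx (negbTE (edge_neq j)).
  by move: bb'; case: b b' (s _) (s _) => [] [] [] [].
apply: eq_bigr => u /andP[/negbTE ul /negbTE ur].
by rewrite ffunE ul ur.
Qed.

(** Together with [right_value] this sorts the pair of occupations, increasingly if c and
    decreasingly otherwise, so that inactive edges need no separate case. *)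
Definition left_value (c b b' : bool) := if c then b && b' else b || b'.
Definition right_value (c b b' : bool) := if c then b || b' else b && b'.

Lemma resample_subproof x (c : bool) j :
  #|[pred i | set_edge (val x) j
      (left_value c (val x (edge_left j)) (val x (edge_right j)))
      (right_value c (val x (edge_left j)) (val x (edge_right j))) i]| == k.
Proof.
have /eqP xk := valP x; rewrite card_set_edge ?xk //.
by case: c; case: (val x _) (val x _) => [] [].
Qed.

(* A particle present at exactly one endpoint of the edge [j] is placed on the
   right endpoint if [c], on the left one otherwise. *)
Definition resample (c : bool) j x : config n k :=
  exist (fun s : {ffun 'I_n -> bool} => is_true (#|[pred i | s i]| == k))
    _ (resample_subproof x c j).

Lemma occ_resample c j x i : occ (resample c j x) i =
  if i == j then left_value c (occ x j) (occ x j.+1)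
  else if i == j.+1 then right_value c (occ x j) (occ x j.+1) else occ x i.
Proof.
have -> : occ x j = val x (edge_left j) by rewrite -occE.
have -> : occ x j.+1 = val x (edge_right j) by rewrite -occE.
have [ni|ni] := leqP n i.
  rewrite !occ_out //; have := edge_right_subproof j.
  by do 2 (case: eqP => [?|_]; first lia).
by rewrite -[i]/(val (Ordinal ni)) !occE ffunE -!val_eqE.
Qed.

Lemma resample_id c j x :
  left_value c (occ x j) (occ x j.+1) = occ x j -> resample c j x = x.
Proof.
move=> xj; apply/occ_inj => i; rewrite occ_resample.
case: eqP => [->//|_]; case: eqP => [->|//].
by case: c (occ x j) (occ x j.+1) xj => [] [] [].
Qed.

(** Sorting forgets the previous order of the pair. This is why a discrepancy disappears when its
    own edge is chosen. *)
Lemma resampleK c c' j x : resample c j (resample c' j x) = resample c j x.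
Proof.
apply/occ_inj => i; rewrite !occ_resample !eqxx.
have -> : (j.+1 == j :> nat) = false by lia.
case: eqP => // _; [|case: eqP => // _];
  by case: c c' (occ x j) (occ x j.+1) => [] [] [] [].
Qed.

Lemma resampleC c c' e j x : [|| e.+1 < j | j.+1 < e]%N ->
  resample c e (resample c' j x) = resample c' j (resample c e x).
Proof.
move=> ej; apply/occ_inj => i; rewrite !occ_resample.
have -> : (e == j :> nat) = false by lia.
have -> : (e == j.+1 :> nat) = false by lia.
have -> : (j == e :> nat) = false by lia.
have -> : (j == e.+1 :> nat) = false by lia.
rewrite !eqSS.
have -> : (e.+1 == j :> nat) = false by lia.
have -> : (j.+1 == e :> nat) = false by lia.
have -> : (e == j :> nat) = false by lia.
have -> : (j == e :> nat) = false by lia.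
by case: (i =P e); case: (i =P e.+1); case: (i =P j); case: (i =P j.+1) => //=;
  lia.
Qed.

(** The number of particles on the edge is conserved, so only the prefix that separates its two
    endpoints can change. *)
Lemma count_below_resample c j x i : i != j.+1 ->
  count_below (resample c j x) i = count_below x i.
Proof.
have below m : (m <= j)%N ->
    count_below (resample c j x) m = count_below x m.
  move=> mj; apply: eq_bigr => l _; rewrite occ_resample.
  by have := ltn_ord l; do 2 (case: eqP => [?|_]; first lia).
have above d :
    count_below (resample c j x) (j.+2 + d) = count_below x (j.+2 + d).
  elim: d => [|d IH].
    rewrite addn0 !count_belowS below // !occ_resample !eqxx.
    have -> : (j.+1 == j :> nat) = false by lia.
    by case: (c) (occ x j) (occ x j.+1) => [] [] []; rewrite /= ?addn0 ?addn1.
  rewrite addnS (count_belowS x) (count_belowS (resample c j x)) IH.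
  rewrite occ_resample.
  by do 2 (case: eqP => [?|_]; first lia).
move=> ij; have [/below //|ji] := leqP i j.
by rewrite -(@subnKC j.+2 i) ?above //; lia.
Qed.

Lemma count_below_resample_right j x :
  count_below (resample true j x) j.+1 =
  (count_below x j + (occ x j && occ x j.+1))%N.
Proof.
by rewrite count_belowS count_below_resample ?occ_resample ?eqxx //; lia.
Qed.

(** Sets of sites closed upwards for a total order are nested, and nested sets with k elements each
    are equal. Applied to [leq] and [geq], it identifies the two extremal configurations. *)
Lemma eq_of_order (r : rel nat) x y : total r ->
  (forall i l, (i < n)%N -> (l < n)%N -> r i l -> occ x i -> occ x l) ->
  (forall i l, (i < n)%N -> (l < n)%N -> r i l -> occ y i -> occ y l) -> x = y.
Proof.
move=> r_total.
have sub (z t : config n k) u :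
    (forall i l, (i < n)%N -> (l < n)%N -> r i l -> occ z i -> occ z l) ->
    (forall i l, (i < n)%N -> (l < n)%N -> r i l -> occ t i -> occ t l) ->
    val z u -> ~~ val t u -> z = t.
  move=> rz rt zu tu.
  have tz : [set i | val t i] \subset [set i | val z i].
    apply/fintype.subsetP => i; rewrite !inE -!occE => ti.
    have /orP[iu|ui] := r_total i u.
      by case/negP: tu; rewrite -(occE t); apply: (rt i u).
    by apply: (rz u i (ltn_ord u) (ltn_ord i) ui); rewrite occE.
  have : [set i | val t i] == [set i | val z i].
    rewrite eqEcard tz !cardsE.
    by have /eqP := valP t; have /eqP := valP z; rewrite /= => -> ->.
  by move=> /eqP/setP/(_ u); rewrite !inE (negbTE tu) zu.
move=> rx ry; apply/eqP/negPn/negP => xy.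
have [u] : exists u, val x u != val y u.
  by apply/existsP; apply: contraNT xy; rewrite negb_exists => /forallP xy;
     apply/eqP/val_inj/ffunP => u; apply/eqP/negPn.
case xu: (val x u); case yu: (val y u) => // _; case/eqP: xy.
  by apply: (sub x y u); rewrite ?xu ?yu.
by apply/esym/(sub y x u); rewrite ?xu ?yu.
Qed.

End Configurations.

(** * Contraction *)

Section Alpha.
Context {R : realType}.
Implicit Type beta : R.

Lemma right_prob_gt0 beta : 0 < beta < 1 -> 0 < right_prob beta.
Proof. by move=> /andP[b0 b1]; rewrite /right_prob; lra. Qed.

Lemma right_prob_lt1 beta : 0 < beta < 1 -> right_prob beta < 1.
Proof. by move=> /andP[b0 b1]; rewrite /right_prob; lra. Qed.

Lemma alpha_sqr beta : 0 < beta < 1 ->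
  alpha beta ^+ 2 = right_prob beta / (1 - right_prob beta).
Proof.
move=> b01; rewrite sqr_sqrtr // divr_ge0 // ?subr_ge0 ltW //.
  exact: right_prob_gt0.
exact: right_prob_lt1.
Qed.

Lemma alpha_sqrE beta : 0 < beta < 1 ->
  (1 - right_prob beta) * alpha beta ^+ 2 = right_prob beta.
Proof.
move=> b01; rewrite alpha_sqr // mulrC divfK // subr_eq0 gt_eqF //.
exact: right_prob_lt1.
Qed.

(** Since alpha^2 = (1 + beta) / (1 - beta), squaring reduces this bound, like [alpha_le], to 1 -
    beta^2 <= 1. *)
Lemma alpha_ge beta : 0 < beta < 1 -> 1 + beta <= alpha beta.
Proof.
move=> /[dup] b01 /andP[b0 b1].
rewrite -(@ler_pXn2r _ 2) ?nnegrE ?sqrtr_ge0 //; last by lra.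
rewrite alpha_sqr // /right_prob ler_pdivlMr; last by lra.
by have := mulr_gt0 b0 b0; nra.
Qed.

Lemma alpha_gt1 beta : 0 < beta < 1 -> 1 < alpha beta.
Proof. by move=> /[dup] /alpha_ge ge /andP[b0 _]; lra. Qed.

Lemma alpha_le beta : 0 < beta < 1 -> alpha beta <= (1 - beta)^-1.
Proof.
move=> /[dup] b01 /andP[b0 b1].
have q0 : 0 < 1 - beta by lra.
rewrite -(@ler_pXn2r _ 2) ?nnegrE ?sqrtr_ge0 ?invr_ge0 ?(ltW q0) //.
rewrite alpha_sqr //.
have -> : right_prob beta / (1 - right_prob beta) = (1 + beta) / (1 - beta).
  by rewrite /right_prob; field; rewrite !gt_eqF //; lra.
rewrite exprVn ler_pdivrMr // expr2 invfM -mulrA mulVf ?gt_eqF // mulr1.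
by rewrite -div1r ler_pdivlMr //; nra.
Qed.

(* Twice [(1 - p) alpha = sqrt (p (1 - p))] is [sqrt (1 - beta ^ 2)]. *)
Lemma right_prob_alpha_le beta : 0 < beta < 1 ->
  2 * ((1 - right_prob beta) * alpha beta) <= 1 - beta ^+ 2 / 2.
Proof.
move=> /[dup] b01 /andP[b0 b1].
have q0 : 0 <= 1 - right_prob beta by rewrite subr_ge0 ltW // right_prob_lt1.
have sq : (2 * ((1 - right_prob beta) * alpha beta)) ^+ 2 = 1 - beta ^+ 2.
  rewrite [LHS](_ : _ = 4 * ((1 - right_prob beta) *
    ((1 - right_prob beta) * alpha beta ^+ 2))); last by ring.
  by rewrite alpha_sqrE // /right_prob; field.
rewrite -(@ler_pXn2r _ 2) // ?nnegrE.
- by rewrite sq; have := sqr_ge0 (beta ^+ 2); nra.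
- by rewrite mulr_ge0 // mulr_ge0 // sqrtr_ge0.
by nra.
Qed.

Definition rate (n : nat) beta : R := 1 - beta ^+ 2 / (2 * (n.-1)%:R).

End Alpha.

Section Contraction.
Context {R : realType} {n k : nat} (beta : R) (beta01 : 0 < beta < 1).
Implicit Types (x y : config n k) (f : config n k -> R) (j e : 'I_n.-1).

Local Notation p := (right_prob beta).
Local Notation a := (alpha beta).

Let p_ge0 : 0 <= p. Proof. exact/ltW/right_prob_gt0. Qed.
Let q_ge0 : 0 <= 1 - p.
Proof. by rewrite subr_ge0; exact/ltW/right_prob_lt1. Qed.
Let a_gt0 : 0 < a. Proof. exact: lt_trans ltr01 (alpha_gt1 beta01). Qed.
Let a_neq0 : a != 0. Proof. by rewrite gt_eqF. Qed.

(** On an inactive edge both resamplings are the identity, so every edge update is a mixture of the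
    same two deterministic maps. Using one edge and one direction for two configurations couples
    their steps. *)
Lemma edge_transitionE j x y : edge_transition beta j x y =
  p * (y == resample true j x)%:R + (1 - p) * (y == resample false j x)%:R.
Proof.
have lE : val x (edge_left j) = occ x j by rewrite -occE.
have rE : val x (edge_right j) = occ x j.+1 by rewrite -occE.
rewrite /edge_transition lE rE; case: eqP => [xj|/eqP xj].
  rewrite !resample_id /= ?xj ?andbb ?orbb //.
  by rewrite -mulrDl addrC subrK mul1r.
have -> : place (val x) (edge_right j) (edge_left j) = val (resample true j x).
  apply/ffunP => u; rewrite !ffunE -!val_eqE /= lE rE.
  move: xj; case: (occ x j) (occ x j.+1) => [] [] //= _;
    by case: eqP => // ->; rewrite gtn_eqF.
have -> : place (val x) (edge_left j) (edge_right j) = val (resample false j x).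
  by apply/ffunP => u; rewrite !ffunE -!val_eqE /= lE rE;
     move: xj; case: (occ x j) (occ x j.+1) => [] [].
by rewrite !val_eqE.
Qed.

Lemma markov_op_exclusion f x :
  markov_op (@exclusion_transition R n k beta) f x =
  (n.-1)%:R^-1 * \sum_(j < n.-1)
    (p * f (resample true j x) + (1 - p) * f (resample false j x)).
Proof.
have sum_delta z : \sum_y (y == z)%:R * f y = f z.
  rewrite (bigD1 z) //= eqxx mul1r big1 ?addr0 // => y /negbTE ->.
  by rewrite mul0r.
rewrite /markov_op /exclusion_transition.
under eq_bigr do rewrite -mulrA mulr_suml.
rewrite -mulr_sumr exchange_big /=; congr (_ * _); apply: eq_bigr => j _.
under eq_bigr do rewrite edge_transitionE mulrDl -(mulrA p) -(mulrA (1 - p)).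
by rewrite big_split /= -!mulr_sumr !sum_delta.
Qed.

Lemma exclusion_stochastic : (2 <= n)%N ->
  is_stochastic (@exclusion_transition R n k beta).
Proof.
move=> n2; split=> [x y|x].
  rewrite mulr_ge0 ?invr_ge0 //; apply: sumr_ge0 => j _.
  by rewrite edge_transitionE addr_ge0 // mulr_ge0.
have := markov_op_exclusion (fun=> 1) x; rewrite /markov_op.
under eq_bigr do rewrite mulr1; move=> ->.
under eq_bigr do rewrite !mulr1 addrC subrK.
by rewrite sumr_const card_ord mulVf // pnatr_eq0; lia.
Qed.

(* Moving a particle from [i] to [i + 1] flips the cell of the k x (n - k)
   rectangle with coordinates (particles to the left of [i], vacancies to the
   left of [i]) = (c, i - c), whose weight is
   [a ^ (c - (i - c) + n - k - 1)]. *)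
Definition weight x (i : nat) : R :=
  a ^+ (n - k - 1) * a ^+ 2 ^+ count_below x i / a ^+ i.

(** Tested only on pairs one rightward jump apart; [lipschitz_osc] extends the control to all
    pairs. *)
Definition edge_lipschitz (L : R) f := forall j x, occ x j -> ~~ occ x j.+1 ->
  `|f (resample true j x) - f x| <= L * weight x j.

Lemma weight_gt0 x i : 0 < weight x i.
Proof. by rewrite divr_gt0 ?mulr_gt0 ?exprn_gt0. Qed.

Lemma weight_count x y i l :
  count_below x i = count_below y l -> i = l -> weight x i = weight y l.
Proof. by rewrite /weight => -> ->. Qed.

Lemma weight_countS x y i l : count_below y l = (count_below x i).+1 ->
  l = i.+1 -> weight y l = weight x i * a.
Proof.
rewrite /weight => -> ->; rewrite !exprS; field.
by rewrite expf_neq0 a_neq0.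
Qed.

Lemma weight_vacant x y i l : count_below y l = count_below x i ->
  l = i.+1 -> weight y l = weight x i / a.
Proof.
rewrite /weight => -> ->; rewrite !exprS; field.
by rewrite expf_neq0 a_neq0.
Qed.

(** The vacancy at j + 1 leaves at most n - k - 1 vacancies among the first j sites, so the total
    exponent of a is nonnegative. This dictates the normalisation a^(n-k-1) in [weight]. *)
Lemma weight_ge1 x j : occ x j -> ~~ occ x j.+1 -> 1 <= weight x j.
Proof.
move=> xj /negbTE xj1; rewrite /weight ler_pdivlMr ?exprn_gt0 // mul1r.
rewrite -exprM -exprD ler_weXn2l ?(ltW (alpha_gt1 beta01)) //.
have := @vacant_below_le n k x j.+2 (edge_right_subproof j).
by rewrite !count_belowS xj xj1; lia.
Qed.

(* The probabilities [p] and [1 - p] come with the weight ratios [1 / a] and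
   [a], and [p / a = (1 - p) * a]. *)
Let p_div_a : p / a = (1 - p) * a.
Proof. by apply: (mulIf a_neq0); rewrite divfK // -mulrA -expr2 alpha_sqrE. Qed.

(** Synchronous coupling of x and y: both use edge e with the same direction. A neighbouring edge
    creates a second discrepancy in only one direction, and the expected extra cost is (1 - p) a
    times w in every case. *)
Lemma edge_contraction L f j e x :
  edge_lipschitz L f -> occ x j -> ~~ occ x j.+1 ->
  `|(p * f (resample true e (resample true j x))
     + (1 - p) * f (resample false e (resample true j x)))
    - (p * f (resample true e x) + (1 - p) * f (resample false e x))|
  <= L * weight x j * (1 - (e == j)%:R
       + (1 - p) * a * ((e.+1 == j :> nat)%:R + (e == j.+1 :> nat)%:R)).
Proof.
move=> fL xj xj1; set y := resample true j x; set w := L * weight x j.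
have combine (B1 B2 : R) :
    `|f (resample true e y) - f (resample true e x)| <= B1 ->
    `|f (resample false e y) - f (resample false e x)| <= B2 ->
    `|(p * f (resample true e y) + (1 - p) * f (resample false e y))
      - (p * f (resample true e x) + (1 - p) * f (resample false e x))|
    <= p * B1 + (1 - p) * B2.
  move=> B1le B2le; rewrite opprD addrACA -!mulrBr.
  apply: le_trans (ler_normD _ _) _; rewrite (normrM p) (normrM (1 - p)).
  rewrite (ger0_norm p_ge0) (ger0_norm q_ge0).
  by rewrite lerD // ler_wpM2l.
have yx : `|f y - f x| <= w by exact: fL.
have yj : occ y j = false by rewrite occ_resample eqxx /= (negbTE xj1) andbF.
have yj1 : occ y j.+1 by rewrite occ_resample eqxx gtn_eqF //= xj.
have y_other (i : nat) : i != j -> i != j.+1 -> occ y i = occ x i.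
  by move=> ij ij1; rewrite occ_resample (negbTE ij) (negbTE ij1).
have cy (i : nat) : i != j.+1 -> count_below y i = count_below x i.
  exact: count_below_resample.
have [ej|ej] := eqVneq e j.
  rewrite ej !resampleK subrr normr0.
  rewrite (gtn_eqF (ltnSn j)) (ltn_eqF (ltnSn j)).
  by rewrite addr0 mulr0 addr0 subrr mulr0.
have ej' : (e : nat) != j by [].
rewrite mulr0n subr0.
have [ej1|ej1] := eqVneq e.+1 (j : nat).
  have -> : (e == j.+1 :> nat) = false by clear -ej1; lia.
  rewrite mulr0n mulr1n addr0 mulr1.
  have cx : count_below x j = (count_below x e + occ x e)%N.
    by rewrite -ej1 count_belowS.
  have ne_e : (e : nat) != j.+1 by clear -ej1; lia.
  have ye : occ y e = occ x e by exact: y_other.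
  (* On the sites e, j, j + 1, x reads 110 and y reads 101. Only y can move, rightwards, at cost w /
     a. *)
  have [xe|xe] := boolP (occ x e).
    have wy : weight y e = weight x j / a.
      apply: (canRL (mulfK a_neq0)); apply/esym/weight_countS => //.
      by rewrite cx xe addn1 cy.
    have up_x : resample true e x = x.
      by apply: resample_id; rewrite /= ej1 xe xj.
    have down_x : resample false e x = x.
      by apply: resample_id; rewrite /= ej1 xe xj.
    have down_y : resample false e y = y.
      by apply: resample_id; rewrite /= ej1 ye xe yj.
    apply: le_trans (combine (w / a + w) w _ _) _.
    - rewrite up_x; apply: le_trans (ler_distD (f y) _ _) _.
      apply: lerD => //; rewrite /w -mulrA -wy.
      by apply: fL; rewrite ?ej1 ?ye ?xe ?yj.
    - by rewrite down_x down_y.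
    rewrite mulrDr [p * (w / a)]mulrCA p_div_a.
    by rewrite -subr_ge0 [leRHS](_ : _ = 0) //; ring.
  (* Here x reads 010 and y reads 001. Only x can move, leftwards, to z = 100; the cost w a is read
     off the jump from z back to x. *)
  pose z := resample false e x.
  have ze : occ z e by rewrite occ_resample eqxx /= ej1 xj orbT.
  have ze1 : ~~ occ z e.+1.
    by rewrite occ_resample (gtn_eqF (ltnSn e)) eqxx /= (negbTE xe).
  have upz : resample true e z = x.
    by rewrite /z resampleK resample_id //= (negbTE xe).
  have cz : count_below z e = count_below x e.
    by apply: count_below_resample; rewrite ltn_eqF.
  have wz : weight z e = weight x j * a.
    apply: (canRL (mulfVK a_neq0)); apply/esym/weight_vacant => //.
    by rewrite cx (negbTE xe) addn0 cz.
  have up_x : resample true e x = x.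
      by apply: resample_id; rewrite /= (negbTE xe).
  have up_y : resample true e y = y.
    by apply: resample_id; rewrite /= ye (negbTE xe).
  have down_y : resample false e y = y.
    by apply: resample_id; rewrite /= ej1 ye (negbTE xe) yj.
  apply: le_trans (combine w (w + w * a) _ _) _.
  - by rewrite up_x up_y.
  - rewrite down_y -/z; apply: le_trans (ler_distD (f x) _ _) _.
    apply: lerD => //; rewrite /w -mulrA -wz -{1}upz.
    exact: fL.
  by rewrite -subr_ge0 [leRHS](_ : _ = 0) //; ring.
rewrite mulr0n add0r.
have [ej2|ej2] := eqVneq (e : nat) j.+1.
  rewrite mulr1n mulr1.
  have xe : occ x e = false by rewrite ej2 (negbTE xj1).
  have ye : occ y e by rewrite ej2.
  have ye1 : occ y e.+1 = occ x e.+1 by apply: y_other; clear -ej2; lia.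
  have cx : count_below x e = (count_below x j).+1.
    by rewrite ej2 count_belowS xj addn1.
  (* On the sites j, e, e + 1, either x = 101 and y = 011, where only x moves, leftwards, to z = 110
     at cost w a; or x = 100 and y = 010, where only y moves, rightwards, at cost w / a. *)
  have [xe1|xe1] := boolP (occ x e.+1).
    pose z := resample false e x.
    have ze : occ z e by rewrite occ_resample eqxx /= xe1 orbT.
    have ze1 : ~~ occ z e.+1.
      by rewrite occ_resample (gtn_eqF (ltnSn e)) eqxx /= xe.
    have upz : resample true e z = x.
      by rewrite /z resampleK resample_id //= xe.
    have cz : count_below z e = count_below x e.
      by apply: count_below_resample; rewrite ltn_eqF.
    have wz : weight z e = weight x j * a.
      by apply: weight_countS => //; rewrite cz cx.
    have up_x : resample true e x = x.
      by apply: resample_id; rewrite /= xe.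
    have up_y : resample true e y = y.
      by apply: resample_id; rewrite /= ye ye1 xe1.
    have down_y : resample false e y = y by apply: resample_id; rewrite /= ye.
    apply: le_trans (combine w (w + w * a) _ _) _.
    - by rewrite up_x up_y.
    - rewrite down_y -/z; apply: le_trans (ler_distD (f x) _ _) _.
      apply: lerD => //; rewrite /w -mulrA -wz -{1}upz.
      exact: fL.
    by rewrite -subr_ge0 [leRHS](_ : _ = 0) //; ring.
  have wy : weight y e = weight x j / a.
    apply: weight_vacant => //.
    by rewrite ej2 count_below_resample_right (negbTE xj1) andbF addn0.
  have up_x : resample true e x = x.
      by apply: resample_id; rewrite /= xe.
  have down_x : resample false e x = x.
    by apply: resample_id; rewrite /= xe (negbTE xe1).
  have down_y : resample false e y = y by apply: resample_id; rewrite /= ye.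
  apply: le_trans (combine (w / a + w) w _ _) _.
  - rewrite up_x; apply: le_trans (ler_distD (f y) _ _) _.
    apply: lerD => //; rewrite /w -mulrA -wy.
    by apply: fL; rewrite ?ye1.
  - by rewrite down_x down_y.
  rewrite mulrDr [p * (w / a)]mulrCA p_div_a.
  by rewrite -subr_ge0 [leRHS](_ : _ = 0) //; ring.
(* The edges share no vertex: the updates commute and the discrepancy keeps its weight. *)
have far_ej : (e.+1 < j)%N || (j.+1 < e)%N by clear -ej' ej1 ej2; lia.
have j_e1 : (j : nat) != e.+1 by rewrite eq_sym.
have j1_e : (j.+1 : nat) != e by rewrite eq_sym.
have j1_e1 : (j.+1 : nat) != e.+1 by rewrite eqSS eq_sym.
have j_e : (j : nat) != e by rewrite eq_sym.
have far c : `|f (resample c e y) - f (resample c e x)| <= w.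
  have -> : resample c e y = resample true j (resample c e x).
    exact: resampleC.
  have -> : w = L * weight (resample c e x) j.
    congr (_ * _); apply: weight_count => //; apply/esym.
    exact: count_below_resample.
  apply: fL; rewrite occ_resample.
    by rewrite (negbTE j_e) (negbTE j_e1).
  by rewrite (negbTE j1_e) (negbTE j1_e1).
rewrite mulr0n mulr0 addr0 mulr1.
apply: le_trans (combine w w _ _) _ => //.
by rewrite -subr_ge0 [leRHS](_ : _ = 0) //; ring.
Qed.

(** Summing over the n - 1 edges, the edge j loses 1 and its at most two neighbours add 2 (1 - p) a
    <= 1 - beta^2 / 2, a net loss of at least beta^2 / 2. *)
Lemma lipschitz_markov_op L f : edge_lipschitz L f ->
  edge_lipschitz (L * rate n beta)
    (markov_op (@exclusion_transition R n k beta) f).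
Proof.
move=> fL j x xj xj1; rewrite !markov_op_exclusion -mulrBr -sumrB.
have n0 : 0 < (n.-1)%:R :> R by rewrite ltr0n; have := ltn_ord j; lia.
rewrite normrM ger0_norm ?invr_ge0 ?(ltW n0) // mulrC ler_pdivrMr //.
apply: le_trans (ler_norm_sum _ _ _) _.
apply: le_trans (ler_sum _ (fun e _ => edge_contraction e fL xj xj1)) _.
have w0 : 0 <= L * weight x j by apply: le_trans (fL j x xj xj1).
rewrite -mulr_sumr.
rewrite [leRHS](_ : _ = L * weight x j * (rate n beta * (n.-1)%:R)); last ring.
apply: ler_wpM2l => //; rewrite big_split sumrB /= -mulr_sumr.
have -> : rate n beta * (n.-1)%:R = (n.-1)%:R - beta ^+ 2 / 2.
  by rewrite /rate; field; rewrite gt_eqF.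
(* At an end of the segment a neighbouring edge is missing, hence an inequality. *)
have sum1 (P : pred 'I_n.-1) : (forall e e', P e -> P e' -> e = e') ->
    \sum_e (P e)%:R <= 1 :> R.
  move=> P1; have [[e0 Pe0]|noP] := pselect (exists e, P e).
    rewrite (bigD1 e0) //= Pe0 big1 ?addr0 // => e ee0.
    by case Pe: (P e) => //; rewrite (P1 e e0) ?eqxx // in ee0.
  by rewrite big1 // => e _; case Pe: (P e) => //; case: noP; exists e.
have -> : \sum_(e < n.-1) (e == j)%:R = 1 :> R.
  by rewrite (bigD1 j) //= eqxx big1 ?addr0 // => e /negbTE ->.
rewrite sumr_const card_ord big_split /=.
have s1 : \sum_(e < n.-1) (e.+1 == j :> nat)%:R <= 1 :> R.
  by apply: sum1 => e e' /eqP h /eqP h'; apply: val_inj => /=; clear -h h'; lia.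
have s2 : \sum_(e < n.-1) (e == j.+1 :> nat)%:R <= 1 :> R.
  by apply: sum1 => e e' /eqP h /eqP h'; apply: val_inj => /=; clear -h h'; lia.
have := right_prob_alpha_le beta01.
have := ler_wpM2l (mulr_ge0 q_ge0 (ltW a_gt0)) (lerD s1 s2).
by lra.
Qed.

End Contraction.

(** * Total weight and oscillation *)

Section Diameter.
Context {R : realType} {n k : nat} {beta : R}.
Context (beta01 : 0 < beta < 1) (kn : (1 <= k <= n - 1)%N).
Implicit Types (x y z : config n k) (f : config n k -> R) (j : 'I_n.-1).

Local Notation a := (alpha beta).

Let a_gt1 : 1 < a. Proof. exact: alpha_gt1. Qed.
Let a_gt0 : 0 < a. Proof. exact: lt_trans ltr01 a_gt1. Qed.
Let a_neq0 : a != 0. Proof. by rewrite gt_eqF. Qed.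
Let a_neq1 : a - 1 != 0. Proof. by rewrite subr_eq0 gt_eqF. Qed.

(** Row of a particle at i with c particles on its left: the cells (c, b), one for each b below the
    number of vacancies on its left, of weight a^(n-k-1+c-b). *)
Definition row_area x (i : nat) : R := (occ x i)%:R *
  (a ^+ (n - k - 1) * a ^+ count_below x i *
   \sum_(b < i - count_below x i) a^-1 ^+ b).

(* Total weight of the cells below the lattice path [x]: each particle
   contributes one cell per vacancy on its left. *)
Definition area x : R := \sum_(i < n) row_area x i.

(** Only the row of the jumping particle changes: it gains the cell with b = j - c. *)
Lemma area_resample j x : occ x j -> ~~ occ x j.+1 ->
  area (resample true j x) = area x + weight beta x j.
Proof.
move=> xj xj1; set y := resample true j x.
have split_area z : area z = row_area z j + row_area z j.+1 +
    \sum_(i < n | (i != edge_left j) && (i != edge_right j)) row_area z i.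
  rewrite /area (bigD1 (edge_left j)) //= (bigD1 (edge_right j)) ?edge_neq //=.
  by rewrite addrA.
have cy (i : nat) : i != j.+1 -> count_below y i = count_below x i.
  exact: count_below_resample.
have yj : occ y j = false by rewrite occ_resample eqxx /= (negbTE xj1) andbF.
have yj1 : occ y j.+1 by rewrite occ_resample eqxx gtn_eqF //= xj.
have cyj1 : count_below y j.+1 = count_below x j.
  by rewrite count_below_resample_right (negbTE xj1) andbF addn0.
rewrite !split_area [RHS]addrAC; congr (_ + _).
  rewrite /row_area yj yj1 xj (negbTE xj1) cyj1 !mul0r !mul1r add0r addr0.
  have cj := count_below_bound x j.
  rewrite subSn // big_ord_recr /= mulrDr; congr (_ + _).
  have aj : a ^+ j = a ^+ count_below x j * a ^+ (j - count_below x j).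
    by rewrite -exprD subnKC.
  rewrite /weight aj exprAC expr2 exprVn.
  have := expf_neq0 (count_below x j) a_neq0.
  have := expf_neq0 (j - count_below x j) a_neq0.
  move: (a ^+ (n - k - 1)) (a ^+ _) (a ^+ _) => K v u v0 u0.
  by field; rewrite v0 u0.
apply: eq_bigr => i /andP[il ir].
have il' : (i : nat) != j by exact: il.
have ir' : (i : nat) != j.+1 by exact: ir.
by rewrite /row_area cy // occ_resample (negbTE il') (negbTE ir').
Qed.

Lemma area_ge0 x : 0 <= area x.
Proof.
apply: sumr_ge0 => i _; rewrite !mulr_ge0 ?exprn_ge0 ?(ltW a_gt0) //.
by apply: sumr_ge0 => b _; rewrite exprn_ge0 // invr_ge0 ltW.
Qed.

(** Weight of the whole rectangle: the sum of a^c over c < k times the sum of a^(n-k-1-b) over b < n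
    - k. *)
Definition diameter : R := (a ^+ k - 1) * (a ^+ (n - k) - 1) / (a - 1) ^+ 2.

(** The sum telescopes: a particle with c particles on its left contributes a^(c+1) - a^c, a vacancy
    nothing. *)
Lemma sum_occ_expr x i :
  (a - 1) * \sum_(l < i) (occ x l)%:R * a ^+ count_below x l =
  a ^+ count_below x i - 1.
Proof.
elim: i => [|i IH]; first by rewrite /count_below !big_ord0 mulr0 expr0 subrr.
rewrite big_ord_recr /= mulrDr IH count_belowS.
by case: (occ x i); rewrite /= ?addn0 ?addn1 ?exprS; ring.
Qed.

(** Extending every row to all n - k columns makes the total factor into two geometric sums. *)
Lemma area_le x : area x <= diameter.
Proof.
have m0 : (0 < n - k)%N by lia.
have geom : a ^+ (n - k - 1) * \sum_(b < n - k) a^-1 ^+ b =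
            (a ^+ (n - k) - 1) / (a - 1).
  apply: (canRL (mulfK a_neq1)); rewrite -(ltn_predK m0) subn1 /=.
  elim: (_.-1) => [|m IH].
    by rewrite big_ord1 expr0 !mul1r expr1.
  have top : a ^+ m.+1 * a^-1 ^+ m.+1 = 1 by rewrite -exprMn divff // expr1n.
  rewrite big_ord_recr /= [a ^+ m.+1 * _]mulrDr top.
  move: IH; set s := \sum_(_ < _) _ => IH.
  rewrite [RHS](_ : _ = a * (a ^+ m.+1 - 1) + (a - 1)).
    by rewrite -IH exprS; ring.
  by rewrite exprS; ring.
apply: (@le_trans _ _ (\sum_(i < n) (occ x i)%:R * a ^+ count_below x i *
    ((a ^+ (n - k) - 1) / (a - 1)))).
  apply: ler_sum => i _; rewrite -mulrA; apply: ler_wpM2l => //.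
  rewrite mulrAC mulrC; apply: ler_wpM2l; first by rewrite exprn_ge0 // ltW.
  rewrite -geom; apply: ler_wpM2l; first by rewrite exprn_ge0 // ltW.
  have le_m := vacant_below_le x (ltnW (ltn_ord i)).
  rewrite (big_ord_widen _ (fun b => a^-1 ^+ b) le_m) big_mkcond /=.
  apply: ler_sum => b _; case: ifP => // _.
  by rewrite exprn_ge0 // invr_ge0 ltW.
rewrite -mulr_suml; have := sum_occ_expr x n; rewrite count_below_size => e.
by rewrite /diameter -e; rewrite -subr_ge0 [leRHS](_ : _ = 0) //; field.
Qed.

Lemma top_unique x y :
  (forall j, occ x j -> occ x j.+1) -> (forall j, occ y j -> occ y j.+1) ->
  x = y.
Proof.
have up z : (forall j, occ z j -> occ z j.+1) ->
    forall i l, (i < n)%N -> (l < n)%N ->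
    (i <= l)%N -> occ z i -> occ z l.
  move=> zj i l ni nl il zi.
  rewrite -(subnKC il) in nl *; elim: (l - i)%N nl => [|d IH] nl.
    by rewrite addn0.
  have nd : (i + d < n.-1)%N by lia.
  by rewrite addnS; apply: (zj (Ordinal nd)); apply: IH; lia.
move=> xj yj; apply: (@eq_of_order _ _ leq); [|exact: up|exact: up].
exact: leq_total.
Qed.

Lemma bottom_unique x y :
  (forall j, occ x j.+1 -> occ x j) -> (forall j, occ y j.+1 -> occ y j) ->
  x = y.
Proof.
have down z : (forall j, occ z j.+1 -> occ z j) ->
    forall i l, (i < n)%N -> (l < n)%N ->
    (l <= i)%N -> occ z i -> occ z l.
  move=> zj i l ni nl il.
  rewrite -(subnKC il) in ni *; elim: (i - l)%N ni => [|d IH] ni.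
    by rewrite addn0.
  have nd : (l + d < n.-1)%N by lia.
  by rewrite addnS => /(zj (Ordinal nd)); apply: IH; lia.
move=> xj yj; apply: (@eq_of_order _ _ geq); [|exact: down|exact: down].
by move=> i l; exact: leq_total.
Qed.

(** No path is built: among the configurations satisfying the bound, take one of maximal area. A
    rightward jump would keep the bound and increase the area. *)
Lemma reach_top L f x : edge_lipschitz beta L f -> 
  exists2 z, forall j, occ z j -> occ z j.+1 &
             `|f z - f x| <= L * (area z - area x).
Proof.
move=> fL; pose P z := `|f z - f x| <= L * (area z - area x).
have Px : P x by rewrite /P !subrr normr0 mulr0.
case: (@arg_maxP _ _ _ x P area Px) => z Pz zmax; exists z => // j zj.
apply: contraT => zj1; have := weight_gt0 beta01 z j.
suff Py : P (resample true j z).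
  have : area (resample true j z) <= area z by exact: zmax.
  by rewrite area_resample //; lra.
rewrite /P area_resample //; apply: le_trans (ler_distD (f z) _ _) _.
rewrite [area z + _]addrC -addrA mulrDr; apply: lerD => //; exact: fL.
Qed.

Lemma reach_bottom L f x : edge_lipschitz beta L f -> 
  exists2 z, forall j, occ z j.+1 -> occ z j &
             `|f z - f x| <= L * (area x - area z).
Proof.
move=> fL; pose P z := `|f z - f x| <= L * (area x - area z).
have Px : P x by rewrite /P !subrr normr0 mulr0.
case: (@arg_minP _ _ _ x P area Px) => z Pz zmin; exists z => // j zj1.
(* A leftward jump from z leads to y, and z is y after the reverse jump, so y has smaller area. *)
apply: contraT => zj; pose y := resample false j z.
have yj : occ y j by rewrite occ_resample eqxx /= zj1 orbT.
have yj1 : ~~ occ y j.+1.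
  by rewrite occ_resample (gtn_eqF (ltnSn j)) eqxx /= (negbTE zj).
have zy : resample true j y = z.
  by rewrite /y resampleK resample_id //= (negbTE zj).
have := weight_gt0 beta01 y j; have := area_resample yj yj1; rewrite zy => az.
suff Py : P y.
  have : area z <= area y by exact: zmin.
  by rewrite az; lra.
have := fL j y yj yj1; rewrite zy distrC => yz.
rewrite /P; apply: le_trans (ler_distD (f z) _ _) _.
rewrite (_ : area x - area y = weight beta y j + (area x - area z)).
  by rewrite mulrDr lerD.
by rewrite az; ring.
Qed.

(* Routing through the top configuration costs at most
   [2 * diameter - area x - area y] and through the bottom one at most
   [area x + area y]; the smaller of the two is at most [diameter]. *)
Lemma lipschitz_osc L f x y : 0 <= L -> edge_lipschitz beta L f ->
  `|f x - f y| <= L * diameter.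
Proof.
move=> L0 fL.
have [t tt xt] := reach_top x fL; have [t' tt' yt] := reach_top y fL.
rewrite -(top_unique tt tt') {t' tt'} in yt.
have [b bb xb] := reach_bottom x fL; have [b' bb' yb] := reach_bottom y fL.
rewrite -(bottom_unique bb bb') {b' bb'} in yb.
have viat := ler_distD (f t) (f x) (f y).
have viab := ler_distD (f b) (f x) (f y).
rewrite distrC in xt; rewrite distrC in xb.
have := ler_wpM2l L0 (area_le t); have := ler_wpM2l L0 (area_ge0 b).
rewrite !mulrBr in xt yt xb yb; lra.
Qed.

End Diameter.

(** * Mixing time *)

Section MixingTime.
Context {R : realType} {n k : nat} (beta : R).
Context (n2 : (2 <= n)%N) (kn : (1 <= k <= n - 1)%N) (beta01 : 0 < beta < 1).

Local Notation a := (alpha beta).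
Local Notation D := (@diameter R n k beta).

Let n1_ge1 : 1 <= (n.-1)%:R :> R. Proof. by rewrite ler1n; lia. Qed.

Lemma rate_ge0 : 0 <= rate n beta.
Proof.
have /andP[b0 b1] := beta01.
have b2 : beta ^+ 2 <= 1 by rewrite exprn_ile1 // ltW.
have n1 := n1_ge1.
by rewrite subr_ge0 ler_pdivrMr ?mul1r; lra.
Qed.

Lemma edge_lipschitz_iter t (f : config n k -> R) L : edge_lipschitz beta L f ->
  edge_lipschitz beta (L * rate n beta ^+ t)
    (iter t (markov_op (@exclusion_transition R n k beta)) f).
Proof.
move=> fL; elim: t => [|t IH]; first by rewrite expr0 mulr1.
by rewrite exprSr mulrA; apply: lipschitz_markov_op.
Qed.

Lemma exclusion_worst_tv_lt t (eps : R) : 0 < eps ->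
  rate n beta ^+ t * D < eps ->
  worst_tv_distance (@exclusion_transition R n k beta) t < eps.
Proof.
move=> eps0 lt_eps; apply: worst_tv_distance_lt lt_eps _ => //.
  exact: exclusion_stochastic.
move=> A x y; apply: lipschitz_osc => //; first by rewrite exprn_ge0 ?rate_ge0.
rewrite -[_ ^+ t]mul1r; apply: edge_lipschitz_iter => j z zj zj1.
rewrite mul1r; apply: le_trans (weight_ge1 beta01 zj zj1).
by case: (_ \in _); case: (_ \in _);
  rewrite ?subrr ?subr0 ?sub0r ?normrN ?normr1 ?normr0.
Qed.

(** All terms of both geometric sums are at least 1, and k (n - k) >= n - 1. For large n this makes
    the logarithm in the bound nonnegative. *)
Lemma diameter_ge : (n.-1)%:R <= D.
Proof.
have a1 := alpha_gt1 beta01.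
have geom m : m%:R <= (a ^+ m - 1) / (a - 1).
  rewrite subrX1 mulrAC divff ?mul1r ?subr_eq0 ?gt_eqF //.
  rewrite -[leLHS]mulr_natl mulr1 -[m in leLHS]card_ord -sumr_const.
  by apply: ler_sum => i _; rewrite exprn_ege1 // ltW.
have -> : D = (a ^+ k - 1) / (a - 1) * ((a ^+ (n - k) - 1) / (a - 1)).
  by rewrite /diameter; field; rewrite subr_eq0 gt_eqF.
apply: le_trans (ler_pM _ _ (geom k) (geom (n - k)%N)); rewrite ?ler0n //.
by rewrite -natrM ler_nat; nia.
Qed.

(** With s = beta^2 / 2, exp s <= 1 / (1 - s) <= 1 + beta <= a. *)
Lemma expR_half_sqr_le : expR (beta ^+ 2 / 2) <= a.
Proof.
have /andP[b0 b1] := beta01.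
apply: le_trans (alpha_ge beta01).
have b2 : 0 < 1 - beta ^+ 2 / 2 by nra.
have := expR_ge1Dx (- (beta ^+ 2 / 2)).
rewrite expRN => /(le_trans _) h.
rewrite -[leLHS]invrK -[leRHS]invrK.
rewrite lef_pV2 ?posrE ?invr_gt0 ?expR_gt0 //; last lra.
apply: h; rewrite -[leLHS]mul1r ler_pdivrMr; last lra.
by nra.
Qed.

(* The factor [a] in the logarithm pays for rounding the time down to an
   integer. *)
Lemma exclusion_tmix_le (eps : R) : 0 < eps -> eps <= (n.-1)%:R ->
  (exclusion_tmix n k beta eps <=
    (2 * n%:R / beta ^+ 2 * (ln (1 / eps)
       + ln (a * (a ^+ k - 1) * (a ^+ (n - k) - 1) / (a - 1) ^+ 2)))%:E)%E.
Proof.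
move=> eps0 eps_n; have /andP[b0 b1] := beta01; have a1 := alpha_gt1 beta01.
have a0 : 0 < a by exact: lt_trans a1.
have D_ge : eps <= D := le_trans eps_n diameter_ge.
have D0 : 0 < D := lt_le_trans eps0 D_ge.
have -> : a * (a ^+ k - 1) * (a ^+ (n - k) - 1) / (a - 1) ^+ 2 = a * D.
  by rewrite /diameter !mulrA.
have aD0 : 0 < a * D by exact: mulr_gt0.
rewrite -lnM ?posrE ?div1r ?invr_gt0 //.
set X := _ * (a * D); have X0 : 0 < X by rewrite mulr_gt0 // invr_gt0.
have X1 : 1 <= X by rewrite /X ler_pdivlMl // mulr1; nra.
have lnX0 : 0 <= ln X by exact: ln_ge0.
set T := _ * ln X.
have T0 : 0 <= T.
  apply: mulr_ge0 => //; apply: divr_ge0; last exact: sqr_ge0.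
  by rewrite mulr_ge0.
have /andP[tT Tt] := truncn_itv T0; set t := Num.truncn T in tT Tt.
apply: (@le_trans _ _ (t%:R%:E)); last by rewrite lee_fin.
apply: ereal_inf_lbound; exists t => //; apply: exclusion_worst_tv_lt => //.
set d := beta ^+ 2 / (2 * (n.-1)%:R).
have n0 : 0 < (n.-1)%:R :> R by lra.
have d0 : 0 < d by rewrite divr_gt0 ?exprn_gt0 // mulr_gt0.
have d_le : d <= beta ^+ 2 / 2.
  by rewrite /d invfM mulrA ler_pdivrMr // ler_peMr // divr_ge0 // sqr_ge0.
have rate_le : rate n beta ^+ t <= expR (d - d * t.+1%:R).
  have -> : d - d * t.+1%:R = t%:R * - d by rewrite -natr1; ring.
  rewrite expRM_natl; apply: lerXn2r; rewrite ?nnegrE ?rate_ge0 ?expR_ge0 //.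
  exact: expR_ge1Dx.
(* Here d (2 n / beta^2) = n / (n - 1) >= 1, so ln X <= d T, while T < t + 1. *)
have lnX_lt : ln X < d * t.+1%:R.
  have : d * T < d * t.+1%:R by rewrite ltr_pM2l.
  apply: le_lt_trans; rewrite /T mulrA ler_peMl //.
  have -> : d * (2 * n%:R / beta ^+ 2) = n%:R / (n.-1)%:R.
    by rewrite /d; field; rewrite !gt_eqF.
  by rewrite ler_pdivlMr // mul1r ler_nat leq_pred.
apply: le_lt_trans (ler_wpM2r (ltW D0) rate_le) _.
apply: (@lt_le_trans _ _ (expR (d - ln X) * D)).
  by rewrite ltr_pM2r // ltr_expR ltrD2l ltrN2.
rewrite expRD expRN lnK ?posrE //.
(* Using t in place of t + 1 costs a factor exp d, which a absorbs. *)
have -> : expR d / X * D = eps * (expR d / a).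
  by rewrite /X; field; rewrite !gt_eqF.
rewrite -[leRHS]mulr1 ler_pM2l // ler_pdivrMr // mul1r.
by apply: le_trans expR_half_sqr_le; rewrite ler_expR.
Qed.

(** Uses 1 / (1 - beta) = 1 + beta + beta^2 / (1 - beta) and then beta <= b in the last
    denominator. *)
Lemma alpha_expansion (b : R) : beta <= b -> b < 1 ->
  a <= 1 + (beta + (1 - b)^-1 * beta ^+ 2).
Proof.
move=> bb b1; have /andP[b0 _] := beta01.
apply: le_trans (alpha_le beta01) _.
have -> : (1 - beta)^-1 = 1 + (beta + (1 - beta)^-1 * beta ^+ 2).
  by field; rewrite gt_eqF //; lra.
rewrite !lerD2l ler_wpM2r ?sqr_ge0 // lef_pV2 ?posrE; lra.
Qed.

(** Dropping both -1 terms and using a - 1 >= beta bounds the argument by a a^n / beta^2. Then ln a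
    <= a - 1 is expanded: a^n gives the term in n, and the single a gives the last term since beta^2
    <= beta. *)
Lemma ln_diameter_le (b : R) : beta <= b -> b < 1 ->
  ln (a * (a ^+ k - 1) * (a ^+ (n - k) - 1) / (a - 1) ^+ 2) <=
  n%:R * (beta + (1 - b)^-1 * beta ^+ 2) - 2 * ln beta
  + (1 + (1 - b)^-1) * beta.
Proof.
move=> bb b1; have /andP[b0 _] := beta01; have a1 := alpha_gt1 beta01.
have a0 : 0 < a by exact: lt_trans a1.
have c0 : 0 < (1 - b)^-1 by rewrite invr_gt0 subr_gt0.
have lna : ln a <= beta + (1 - b)^-1 * beta ^+ 2.
  have := alpha_expansion bb b1.
  have : ln (1 + (a - 1)) <= a - 1 by apply: le_ln1Dx; lra.
  by rewrite addrC subrK; lra.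
have beta2 : beta ^+ 2 <= beta by rewrite expr2 ler_piMr ?ltW //; lra.
have pow_gt0 m : (0 < m)%N -> 0 < a ^+ m - 1.
  by move=> m0; rewrite subr_gt0 exprn_egt1 // -lt0n.
have k0 : (0 < k)%N by lia.
have nk0 : (0 < n - k)%N by lia.
have le : a * (a ^+ k - 1) * (a ^+ (n - k) - 1) / (a - 1) ^+ 2 <=
    a * a ^+ n / beta ^+ 2.
  apply: ler_pM.
  - by rewrite !mulr_ge0 ?ltW ?pow_gt0.
  - by rewrite invr_ge0 sqr_ge0.
  - rewrite -mulrA ler_pM2l // -[in leRHS](@subnKC k n); last lia.
    by rewrite exprD; apply: ler_pM; rewrite ?(ltW (pow_gt0 _ _)) // gerBl.
  rewrite lef_pV2 ?posrE ?exprn_gt0 ?subr_gt0 //.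
  apply: lerXn2r; rewrite ?nnegrE ?subr_ge0 ?(ltW b0) ?(ltW a1) //.
  by have := alpha_ge beta01; lra.
apply: le_trans (_ : ln (a * a ^+ n / beta ^+ 2) <= _).
  rewrite ler_ln // posrE.
    by rewrite divr_gt0 ?mulr_gt0 ?pow_gt0 ?exprn_gt0 ?subr_gt0.
  by rewrite divr_gt0 ?mulr_gt0 ?exprn_gt0.
rewrite ln_div ?posrE ?mulr_gt0 ?exprn_gt0 // lnM ?posrE ?exprn_gt0 // !lnXn //.
have := ler_wpM2l (ler0n R n) lna; rewrite mulr_natl -[ln beta *+ 2]mulr_natl.
have := ler_wpM2l (ltW c0) beta2; lra.
Qed.

End MixingTime.

Theorem theorem9 (R : realType) :
  (forall (k : nat -> nat) (beta : nat -> R),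
     (forall n, (2 <= n)%N -> (1 <= k n <= n - 1)%N) ->
     (forall n, (2 <= n)%N -> 0 < beta n < 1) ->
     forall eps : R, 0 < eps ->
     exists N : nat, forall n, (2 <= n)%N -> (N <= n)%N ->
       let a := alpha (beta n) in
       (exclusion_tmix n (k n) (beta n) eps <=
        (2 * n%:R / beta n ^+ 2 *
          (ln (1 / eps)
           + ln (a * (a ^+ k n - 1) * (a ^+ (n - k n) - 1)
                 / (a - 1) ^+ 2)))%:E)%E)
  /\
  (forall b : R, b < 1 ->
   exists C : R, forall (k : nat -> nat) (beta : nat -> R),
     (forall n, (2 <= n)%N -> (1 <= k n <= n - 1)%N) ->
     (forall n, (2 <= n)%N -> 0 < beta n < 1) ->
     (forall n, (2 <= n)%N -> beta n <= b) ->
     (forall n, (2 <= n)%N ->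
        `|alpha (beta n) - (1 + beta n)| <= C * beta n ^+ 2)
     /\
     (exists e1 e2 : nat -> R,
        (forall n, (2 <= n)%N ->
           `|e1 n| <= C * beta n ^+ 2 /\ `|e2 n| <= C * beta n) /\
        forall eps : R, 0 < eps ->
        exists N : nat, forall n, (2 <= n)%N -> (N <= n)%N ->
          (exclusion_tmix n (k n) (beta n) eps <=
           (2 * n%:R / beta n ^+ 2 *
             (ln (eps^-1) + n%:R * (beta n + e1 n)
              - 2 * ln (beta n) + e2 n))%:E)%E)).
Proof.
have large (eps : R) : 0 < eps -> exists N : nat, forall n, (N <= n)%N ->
    eps <= (n.-1)%:R.
  (* One unit pays for rounding eps down, the other for the predecessor of n. *)
  move=> eps0; exists (Num.truncn eps).+2 => n Nn.
  have /andP[_ /ltW le_N] := truncn_itv (ltW eps0).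
  by apply: le_trans le_N _; rewrite ler_nat; lia.
split=> [k beta kn b01 eps eps0|b b1].
  have [N epsN] := large eps eps0; exists N => n n2 Nn.
  exact: (exclusion_tmix_le n2 (kn n n2) (b01 n n2) eps0 (epsN n Nn)).
have c0 : 0 < (1 - b)^-1 by rewrite invr_gt0 subr_gt0.
exists (1 + (1 - b)^-1) => k beta kn b01 bb; split=> [n n2|].
  have := alpha_expansion (b01 n n2) (bb n n2) b1.
  have := sqr_ge0 (beta n); have := alpha_ge (b01 n n2).
  by move=> ge sq le; rewrite ger0_norm; lra.
(* Both error terms are the explicit ones of [ln_diameter_le]; the larger coefficient, that of beta,
   serves as C. *)
exists (fun n => (1 - b)^-1 * beta n ^+ 2).
exists (fun n => (1 + (1 - b)^-1) * beta n).
split=> [n n2|eps eps0].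
  have /andP[b0 _] := b01 n n2; have sq := sqr_ge0 (beta n).
  rewrite !ger0_norm ?mulr_ge0 ?addr_ge0 ?(ltW c0) ?(ltW b0) //; split=> //.
  by rewrite ler_wpM2r // lerDr.
have [N epsN] := large eps eps0; exists N => n n2 Nn.
apply: le_trans (exclusion_tmix_le n2 (kn n n2) (b01 n n2) eps0 (epsN n Nn)) _.
rewrite lee_fin div1r; apply: ler_wpM2l.
  by apply: divr_ge0; [rewrite mulr_ge0|exact: sqr_ge0].
have := ln_diameter_le n2 (kn n n2) (b01 n n2) (bb n n2) b1; lra.
Qed.
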